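(* Let $F$ be a finite field of characteristic $2$, and let $A=(a_{ij})_{1\le i,j\le 3}$ be a $3\times3$ matrix over $F$ with $a_{12}a_{23}a_{31}\ne a_{13}a_{32}a_{21}$. Then iterated $2\times2\times2$ block making starting from the brick $A$ leads, after $n$ steps (and up to a choice of basis in each of the three thick spaces), to a direct sum of $2^{2n-1}+2^{n-1}$ matrices $\tilde A=(a_{ij}^{2^n})_{1\le i,j\le3}$ and $2^{2n-1}-2^{n-1}$ matrices $\tilde A^{\mathrm T}=(a_{ji}^{2^n})_{1\le i,j\le3}$.
   Context: Conventions: vectors are rows and operators/matrices act from the right, so in a product the leftmost factor is applied first. Block. Let $V_1,V_2,V_3$ be finite-dimensional vector spaces over $F$ and $B$ a linear operator (''brick'') in $V_1\oplus V_2\oplus V_3$. Let $C=\{0,1\}^3\subset\mathbb Z^3$. To every straight line parallel to the $i$-th axis through points of $C$ attach a copy of $V_i$. To every $\mathbf x\in C$ attach a copy $B^{(\mathbf x)}$ of $B$ acting in the direct sum of the copies of $V_1,V_2,V_3$ attached to the three lines meeting at $\mathbf x$, extended by the identity to the other copies. The $2\times2\times2$ block of bricks $B$ is $\prod_{\mathbf x\in C}B^{(\mathbf x)}$, in any order such that $B^{(\mathbf x)}$ stands to the left of $B^{(\mathbf y)}$ whenever $\mathbf x\ne\mathbf y$ and $x_i\le y_i$ for all $i$ (the result does not depend on this choice). It acts in $\mathbf V_1\oplus\mathbf V_2\oplus\mathbf V_3$, where the thick space $\mathbf V_i$ is the direct sum of the four copies of $V_i$. Iteration. Start with $R^{(0)}=A$,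 $V_1=V_2=V_3=F$; $R^{(k+1)}$ is the $2\times2\times2$ block whose brick is $R^{(k)}$, with the thick spaces of $R^{(k)}$ as the spaces $V_i$. The result after $n$ steps is $R^{(n)}$, acting in a sum of three thick spaces each of dimension $4^n$. Direct sum. ''$R^{(n)}$ leads to a direct sum of $3\times 3$ matrices'' means that there are bases $\{v^{(i)}_k\}_k$ of the three thick spaces ($i=1,2,3$) such that, for each $k$, $R^{(n)}$ preserves the span of $v^{(1)}_k,v^{(2)}_k,v^{(3)}_k$ and acts there by the $k$-th summand $M=(m_{ij})$: $v_k^{(i)}R^{(n)}=\sum_j m_{ij}v_k^{(j)}$. *)

(* Defs.v *)
From HB Require Import structures.
From mathcomp Require Import all_boot all_order all_algebra.

Set Implicit Arguments.
Unset Strict Implicit.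
Unset Printing Implicit Defensive.

Import GRing.Theory.

Local Open Scope ring_scope.

(* C = {0,1}^3, with false for 0 and true for 1. *)
Definition cube : finType := (bool * bool * bool)%type.

(* A straight line through points of C parallel to a given axis is encoded by
   the pair of its two constant coordinates, in the order of the axes. *)
Definition line : finType := (bool * bool)%type.

Definition line1 (x : cube) : line := (x.1.2, x.2).
Definition line2 (x : cube) : line := (x.1.1, x.2).
Definition line3 (x : cube) : line := (x.1.1, x.1.2).

Definition cube_le (x y : cube) : bool :=
  [&& (x.1.1 <= y.1.1)%N, (x.1.2 <= y.1.2)%N & (x.2 <= y.2)%N].

Definition admissible (s : seq cube) : Prop :=
  perm_eq s (enum cube) /\
  forall x y : cube, x != y -> cube_le x y -> (index x s < index y s)%N.

(* All operators act on row vectors from the right, so in the product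
   [rmul f g] of f and g the factor f is applied first. *)
Definition rmul (F : fieldType) (U : vectType F) (f g : 'End(U)) : 'End(U) :=
  (g \o f)%VF.

Section Block.

Variables (F : fieldType) (V1 V2 V3 : vectType F).

Definition thick (V : vectType F) : vectType F := {ffun line -> V}.

Definition set_coord (V : vectType F) (u : {ffun line -> V}) (l : line) (w : V)
    : {ffun line -> V} :=
  [ffun m => if m == l then w else u m].

Definition copy_fun (B : 'End((V1 * V2 * V3)%type)) (x : cube)
    (u : (thick V1 * thick V2 * thick V3)%type)
    : (thick V1 * thick V2 * thick V3)%type :=
  let w := B (u.1.1 (line1 x), u.1.2 (line2 x), u.2 (line3 x)) in
  (set_coord u.1.1 (line1 x) w.1.1,
   set_coord u.1.2 (line2 x) w.1.2,
   set_coord u.2 (line3 x) w.2).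

Fact copy_fun_linear B x : linear (copy_fun B x).
Proof.
move=> a u v; rewrite /copy_fun.
have -> : ((a *: u + v).1.1 (line1 x), (a *: u + v).1.2 (line2 x),
           (a *: u + v).2 (line3 x))
  = a *: (u.1.1 (line1 x), u.1.2 (line2 x), u.2 (line3 x))
    + (v.1.1 (line1 x), v.1.2 (line2 x), v.2 (line3 x)) :> (V1 * V2 * V3)%type.
  by apply/eqP; rewrite !xpair_eqE /= !ffunE !eqxx.
rewrite (linearP B).
apply/eqP; rewrite !xpair_eqE /=.
by do !(apply/andP; split); apply/eqP/ffunP => m; rewrite !ffunE;
  case: eqP.
Qed.

HB.instance Definition _ B x :=
  GRing.isLinear.Build F (thick V1 * thick V2 * thick V3)%type
    (thick V1 * thick V2 * thick V3)%type *:%R (copy_fun B x)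
    (copy_fun_linear B x).

Definition copy (B : 'End((V1 * V2 * V3)%type)) (x : cube)
    : 'End((thick V1 * thick V2 * thick V3)%type) :=
  linfun (copy_fun B x).

Definition block (s : seq cube) (B : 'End((V1 * V2 * V3)%type))
    : 'End((thick V1 * thick V2 * thick V3)%type) :=
  \big[@rmul F _ / \1%VF]_(x <- s) copy B x.

End Block.

Section Iteration.

Variable F : fieldType.

(* Each of the three thick spaces after n steps; they coincide as types since
   V_1 = V_2 = V_3 = F initially. *)
Fixpoint thick_iter (n : nat) : vectType F :=
  if n is m.+1 then thick (thick_iter m) else F^o.

(* Row and column indices 1, 2, 3 of a 3 x 3 matrix are 0, 1, 2 : 'I_3. *)
Definition brick_fun (A : 'M[F]_3) (u : (F^o * F^o * F^o)%type)
    : (F^o * F^o * F^o)%type :=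
  let w j := u.1.1 * A 0 j + u.1.2 * A 1 j + u.2 * A 2 j in
  (w 0, w 1, w 2).

Fact brick_fun_linear A : linear (brick_fun A).
Proof.
move=> a u v; have lin j :
    (a *: u + v).1.1 * A 0 j + (a *: u + v).1.2 * A 1 j + (a *: u + v).2 * A 2 j
  = a * (u.1.1 * A 0 j + u.1.2 * A 1 j + u.2 * A 2 j)
    + (v.1.1 * A 0 j + v.1.2 * A 1 j + v.2 * A 2 j).
  rewrite /= /GRing.scale /= !mulrDl !mulrDr !mulrA.
  by rewrite [RHS]addrACA [in RHS](addrACA (a * _ * _)).
by rewrite /brick_fun !lin.
Qed.

HB.instance Definition _ A :=
  GRing.isLinear.Build F (F^o * F^o * F^o)%type (F^o * F^o * F^o)%type *:%R
    (brick_fun A) (brick_fun_linear A).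

Definition brick (A : 'M[F]_3) : 'End((F^o * F^o * F^o)%type) :=
  linfun (brick_fun A).

(* [ord k] is the order of the eight factors used at step k. *)
Fixpoint iter_block (A : 'M[F]_3) (ord : nat -> seq cube) (n : nat)
    : 'End((thick_iter n * thick_iter n * thick_iter n)%type) :=
  if n is m.+1 then block (ord m) (iter_block A ord m) else brick A.

End Iteration.

Definition leads_to_direct_sum (F : fieldType) (V1 V2 V3 : vectType F)
    (R : 'End((V1 * V2 * V3)%type)) (Ms : seq 'M[F]_3) : Prop :=
  exists (v1 : (size Ms).-tuple V1) (v2 : (size Ms).-tuple V2)
         (v3 : (size Ms).-tuple V3),
    [/\ basis_of fullv v1, basis_of fullv v2, basis_of fullv v3 &
      forall k : 'I_(size Ms), let M := Ms`_k in
        [/\ R (v1`_k, 0, 0) = (M 0 0 *: v1`_k, M 0 1 *: v2`_k, M 0 2 *: v3`_k),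
            R (0, v2`_k, 0) = (M 1 0 *: v1`_k, M 1 1 *: v2`_k, M 1 2 *: v3`_k)
          & R (0, 0, v3`_k) = (M 2 0 *: v1`_k, M 2 1 *: v2`_k, M 2 2 *: v3`_k)]].

(* Main.v *)
From HB Require Import structures.
Require Import Defs.
From mathcomp Require Import all_boot all_order all_algebra ring.

(** The key is the case of one step on a 3 x 3 brick A over a field of
    characteristic 2. Write R for its block and R_ij for the 4 x 4 part of R
    from the i-th thick space to the j-th one. The entries of R are sums over
    the monotone paths through the cube, and in characteristic 2 many paths
    cancel in pairs: for instance R_ii is the scalar a_ii^2. The cyclic product
    R_12 R_23 R_31 then differs from the scalar (a_12 a_23 a_31)^2 by an
    operator of rank one, and the row spanning its image factors as a tensor
    product over the two coordinates that label the lines of direction 1. So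
    does the column spanning its coimage. This suggests to look for vectors of
    the thick spaces that are tensor products of vectors of F^2, and
    [eigtriple] lists four triples of such vectors. Each of them spans a
    subspace preserved by R, with matrix (a_ij^2) for three of them and
    (a_ji^2) for the fourth; this is a polynomial identity modulo 2
    ([eigensystem_summand]). They form bases of the thick spaces because the
    two vectors of F^2 used for each pair of axes have determinant
    a_12 a_23 a_31 - a_13 a_32 a_21 up to sign ([tprod_basis],
    [bit_vec_det]).

    The hypothesis on A passes to A^T and to (a_ij^2), so the step can be
    iterated. If a brick R is a direct sum of matrices M_k, the k-th summand is
    an intertwiner from the brick M_k to R. Block making sends intertwiners to
    intertwiners ([block_intertwines]), hence the block of R is the direct sum
    of the blocks of the M_k, and each of these splits in four
    ([decomposes_block]). If p summands are of the first kind and q are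
    transposed, then one more step gives 3p + q and p + 3q, so that p + q is
    multiplied by 4 and p - q by 2.

    The order of the factors is dealt with by [block_flow]: a block maps the
    values on the incoming edges of the cube to those on the outgoing ones as
    soon as values on all edges satisfy the equation of the brick at each
    vertex, a condition in which the order does not occur. *)

Set Implicit Arguments.
Unset Strict Implicit.
Unset Printing Implicit Defensive.

Import GRing.Theory.

Local Open Scope ring_scope.

(** * Blocks as flows on the edges of the cube *)

Definition on_lines (F : fieldType) (V : vectType F) (f : line -> V)
    : thick V :=
  [ffun l => f l].

Lemma on_linesE (F : fieldType) (V : vectType F) (f : line -> V) l :
  on_lines f l = f l.
Proof. exact: ffunE. Qed.

Section Flow.

Variables (F : fieldType) (V1 V2 V3 : vectType F).
Implicit Types (B : 'End((V1 * V2 * V3)%type)) (x : cube) (s P Q : seq cube).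

Lemma block_nil B u : block [::] B u = u.
Proof. by rewrite /block big_nil id_lfunE. Qed.

Lemma block_cons x s B u : block (x :: s) B u = block s B (copy_fun B x u).
Proof. by rewrite /block big_cons /rmul comp_lfunE lfunE. Qed.

(** A line has three edges, numbered along it by 0, 1, 2, and [e l t] is the
    value on the edge number t of the line l. After the action of the copies at
    the points of P, the copy of V attached to l carries the value on the edge
    whose number is that of the points of P on l. *)
Definition stage (V : vectType F) (pr : cube -> line) (e : line -> nat -> V) P
    : thick V :=
  on_lines (fun l => e l (count (fun y => pr y == l) P)).

Lemma stage_rcons (V : vectType F) (pr : cube -> line) (e : line -> nat -> V)
    P x :
  stage pr e (rcons P x) =
    set_coord (stage pr e P) (pr x)
      (e (pr x) (count (fun z => pr z == pr x) P).+1).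
Proof.
apply/ffunP=> l; rewrite on_linesE ffunE on_linesE -cats1 count_cat /= addn0.
by rewrite eq_sym; case: eqP => [->|_]; rewrite ?addn1 ?addn0.
Qed.

(** When the copy at x acts, the only point of a line through x that can have
    been used before is the other point y of this line, and admissibility
    decides whether it was. *)
Lemma count_line P x Q (pr : cube -> line) (b : bool) y :
    admissible (P ++ x :: Q) -> x != y ->
    (forall z, (pr z == pr x) = (z == x) || (z == y)) ->
    (if b then cube_le y x else cube_le x y) ->
  count (fun z => pr z == pr x) P = b.
Proof.
move=> [perm_s lt_s] neq_xy prE le_xy.
have uniq_s : uniq (P ++ x :: Q) by rewrite (perm_uniq perm_s) enum_uniq.
have [uniqP xNP] : uniq P /\ x \notin P.
  by move: uniq_s; rewrite cat_uniq /= => /and3P[-> /norP[]].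
have idx_x : index x (P ++ x :: Q) = size P.
  by rewrite index_cat (negPf xNP) /= eqxx addn0.
have inP : (y \in P) = (index y (P ++ x :: Q) < index x (P ++ x :: Q))%N.
  rewrite idx_x index_cat; case: ifP => [yP|_]; first by rewrite index_mem yP.
  by rewrite ltnNge leq_addr.
rewrite (eq_in_count (a2 := pred1 y)).
  rewrite count_uniq_mem // inP; case: b le_xy => le_xy.
    by rewrite lt_s // eq_sym.
  by rewrite ltnNge ltnW // lt_s.
move=> z zP /=; rewrite prE; case: eqP => [zx|//].
by rewrite zx in zP; rewrite zP in xNP.
Qed.

(** The coordinate of x along an axis is the number of its incoming edge in
    that direction, so the hypothesis is the equation of the brick at the
    vertex x. The order s occurs only through its admissibility, whence the
    independence of the block from it. *)
Lemma block_flow B s (e1 : line -> nat -> V1) (e2 : line -> nat -> V2)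
    (e3 : line -> nat -> V3) :
    admissible s ->
    (forall x, B (e1 (line1 x) x.1.1, e2 (line2 x) x.1.2, e3 (line3 x) x.2) =
      (e1 (line1 x) x.1.1.+1, e2 (line2 x) x.1.2.+1, e3 (line3 x) x.2.+1)) ->
  block s B (on_lines (fun l => e1 l 0%N), on_lines (fun l => e2 l 0%N),
             on_lines (fun l => e3 l 0%N)) =
    (on_lines (fun l => e1 l 2%N), on_lines (fun l => e2 l 2%N),
     on_lines (fun l => e3 l 2%N)).
Proof.
move=> adm_s flow.
have run Q P : P ++ Q = s ->
    block Q B (stage line1 e1 P, stage line2 e2 P, stage line3 e3 P) =
    (stage line1 e1 s, stage line2 e2 s, stage line3 e3 s).
  elim: Q P => [|x Q IH] P; first by rewrite cats0 => ->; rewrite block_nil.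
  move=> defs; rewrite block_cons.
  rewrite -(IH (rcons P x)); last by rewrite cat_rcons.
  rewrite !stage_rcons /copy_fun /= !on_linesE.
  have admx : admissible (P ++ x :: Q) by rewrite defs.
  rewrite (count_line (b := x.1.1) (y := (~~ x.1.1, x.1.2, x.2)) admx);
    [|by case: (x) => [[[] []] []]|by case: (x) => [[[] []] []] [[[] []] []]
     |by case: (x) => [[[] []] []]].
  rewrite (count_line (b := x.1.2) (y := (x.1.1, ~~ x.1.2, x.2)) admx);
    [|by case: (x) => [[[] []] []]|by case: (x) => [[[] []] []] [[[] []] []]
     |by case: (x) => [[[] []] []]].
  rewrite (count_line (b := x.2) (y := (x.1.1, x.1.2, ~~ x.2)) admx);
    [|by case: (x) => [[[] []] []]|by case: (x) => [[[] []] []] [[[] []] []]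
     |by case: (x) => [[[] []] []]].
  by rewrite flow.
have stage2 (V : vectType F) pr (e : line -> nat -> V) :
    (forall l, count (fun x => pr x == l) (enum cube) = 2%N) ->
  on_lines (fun l => e l 2%N) = stage pr e s.
  move=> pr2; apply/ffunP=> l; rewrite !on_linesE; congr (e l _).
  by have [/permP-> _] := adm_s; rewrite pr2.
rewrite [LHS](run s [::] erefl).
have /permP enum_cube : perm_eq (enum cube)
    [seq (ab, c) | ab <- [seq (a, b) | a <- [:: false; true],
      b <- [:: false; true]], c <- [:: false; true]].
  by apply: uniq_perm; rewrite ?enum_uniq // => -[[[] []] []]; rewrite mem_enum.
by congr (_, _, _); apply: esym; apply: stage2=> -[[] []]; rewrite enum_cube.
Qed.

Definition corners (V : vectType F) (v00 v01 v10 v11 : V) : line -> V :=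
  fun l => if l.1 then if l.2 then v11 else v10 else if l.2 then v01 else v00.

(** The action of the block with the copies taken in the order 000, 100, 010,
    001, 110, 101, 011, 111. The letters a, b, c stand for the three axes and
    the digits for the line; the outgoing edges are primed, the middle ones are
    not. *)
Definition sweep (g : V1 * V2 * V3 -> V1 * V2 * V3)
    (i1 : line -> V1) (i2 : line -> V2) (i3 : line -> V3)
    : (thick V1 * thick V2 * thick V3)%type :=
  let o := false in let i := true in
  let: (a00, b00, c00) := g (i1 (o, o), i2 (o, o), i3 (o, o)) in
  let: (a00', b10, c10) := g (a00, i2 (i, o), i3 (i, o)) in
  let: (a10, b00', c01) := g (i1 (i, o), b00, i3 (o, i)) in
  let: (a01, b01, c00') := g (i1 (o, i), i2 (o, i), c00) in
  let: (a10', b10', c11) := g (a10, b10, i3 (i, i)) in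
  let: (a01', b11, c10') := g (a01, i2 (i, i), c10) in
  let: (a11, b01', c01') := g (i1 (i, i), b01, c01) in
  let: (a11', b11', c11') := g (a11, b11, c11) in
  (on_lines (corners a00' a01' a10' a11'),
   on_lines (corners b00' b01' b10' b11'),
   on_lines (corners c00' c01' c10' c11')).

Lemma block_sweep B g s (i1 : line -> V1) (i2 : line -> V2) (i3 : line -> V3) :
    admissible s -> B =1 g ->
  block s B (on_lines i1, on_lines i2, on_lines i3) = sweep g i1 i2 i3.
Proof.
move=> adm_s Bg; rewrite /sweep.
case E000: (g _) => [[a00 b00] c00]; case E100: (g _) => [[a00' b10] c10].
case E010: (g _) => [[a10 b00'] c01]; case E001: (g _) => [[a01 b01] c00'].
case E110: (g _) => [[a10' b10'] c11]; case E101: (g _) => [[a01' b11] c10'].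
case E011: (g _) => [[a11 b01'] c01']; case E111: (g _) => [[a11' b11'] c11'].
pose flow (V : vectType F) (i m o : line -> V) l t :=
  if t is t'.+1 then if t' is 0%N then m l else o l else i l.
apply: (@block_flow B s
  (flow _ i1 (corners a00 a01 a10 a11) (corners a00' a01' a10' a11'))
  (flow _ i2 (corners b00 b01 b10 b11) (corners b00' b01' b10' b11'))
  (flow _ i3 (corners c00 c01 c10 c11) (corners c00' c01' c10' c11'))
  adm_s) => -[[[] []] []]; rewrite /flow /corners Bg //=.
Qed.

End Flow.

(** * Intertwiners *)

Definition intertwines (F : fieldType) (U1 U2 U3 V1 V2 V3 : vectType F)
    (B : 'End((U1 * U2 * U3)%type)) (R : 'End((V1 * V2 * V3)%type))
    (f1 : U1 -> V1) (f2 : U2 -> V2) (f3 : U3 -> V3) :=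
  forall u, R (f1 u.1.1, f2 u.1.2, f3 u.2) =
    (f1 (B u).1.1, f2 (B u).1.2, f3 (B u).2).

Definition thick_map (F : fieldType) (U V : vectType F) (f : U -> V)
    (u : thick U) : thick V :=
  on_lines (fun l => f (u l)).

(** Block making is functorial, since each factor of a block acts as a brick. *)
Lemma block_intertwines (F : fieldType) (U1 U2 U3 V1 V2 V3 : vectType F)
    (B : 'End((U1 * U2 * U3)%type)) (R : 'End((V1 * V2 * V3)%type))
    (f1 : U1 -> V1) (f2 : U2 -> V2) (f3 : U3 -> V3) s :
  intertwines B R f1 f2 f3 ->
  intertwines (block s B) (block s R)
    (thick_map f1) (thick_map f2) (thick_map f3).
Proof.
move=> BR; elim: s => [|x s IH] u; first by rewrite !block_nil.
rewrite !block_cons -IH /copy_fun /= !on_linesE.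
rewrite (BR (u.1.1 (line1 x), u.1.2 (line2 x), u.2 (line3 x))) /=.
congr (block s R (_, _, _)); apply/ffunP=> l.
all: by rewrite !(on_linesE, ffunE); case: eqP.
Qed.

(** * Direct sums of 3 x 3 matrices *)

Section Summands.

Variables (F : fieldType) (V1 V2 V3 : vectType F).
Variable R : 'End((V1 * V2 * V3)%type).
Implicit Types (t : 'M[F]_3 * (V1 * V2 * V3)).
Implicit Types (T : seq ('M[F]_3 * (V1 * V2 * V3))).

(** A summand is a matrix M with a triple of vectors, one in each space. That
    R acts on the span of the triple by M is expressed as an intertwining
    relation, to which [block_intertwines] applies. *)
Definition summand t :=
  intertwines (brick t.1) R
    ( *:%R^~ t.2.1.1 : F^o -> V1) ( *:%R^~ t.2.1.2 : F^o -> V2)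
    ( *:%R^~ t.2.2 : F^o -> V3).

Definition decomposes T :=
  [/\ basis_of fullv [seq t.2.1.1 | t <- T],
      basis_of fullv [seq t.2.1.2 | t <- T],
      basis_of fullv [seq t.2.2 | t <- T]
    & forall t, t \in T -> summand t].

Lemma brickE (A : 'M[F]_3) : brick A =1 brick_fun A.
Proof. by move=> u; rewrite lfunE. Qed.

Lemma decomposes_perm T T' : perm_eq T T' -> decomposes T -> decomposes T'.
Proof.
move=> TT' [b1 b2 b3 summT]; split; last first.
- by move=> t; rewrite -(perm_mem TT'); apply: summT.
all: by rewrite -(perm_basis _ (perm_map _ TT')).
Qed.

Lemma decomposes_direct_sum T :
  decomposes T -> leads_to_direct_sum R [seq t.1 | t <- T].
Proof.
case=> b1 b2 b3 summT; rewrite /leads_to_direct_sum; set n := size _.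
have sz (V : vectType F) (v : 'M[F]_3 * (V1 * V2 * V3) -> V) :
  size [seq v t | t <- T] == n by rewrite /n !size_map.
exists (Tuple (sz _ (fun t => t.2.1.1))), (Tuple (sz _ (fun t => t.2.1.2))),
  (Tuple (sz _ (fun t => t.2.2))); split=> // -[k lt_kn] /=.
have kT : (k < size T)%N by rewrite -(size_map fst).
pose t := nth (0, (0, 0, 0)) T k.
have /summT st : t \in T by rewrite mem_nth.
have nthE (V : nmodType) (v : 'M[F]_3 * (V1 * V2 * V3) -> V) :
  [seq v t | t <- T]`_k = v t by rewrite (nth_map (0, (0, 0, 0))).
rewrite !nthE; split.
- have := st (1, 0, 0); rewrite brickE /brick_fun /= !scale1r !scale0r => ->.
  by rewrite !mul0r !addr0 !mul1r.
- have := st (0, 1, 0); rewrite brickE /brick_fun /= !scale1r !scale0r => ->.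
  by rewrite !mul0r !addr0 !add0r !mul1r.
- have := st (0, 0, 1); rewrite brickE /brick_fun /= !scale1r !scale0r => ->.
  by rewrite !mul0r !add0r !mul1r.
Qed.

Lemma decomposes_leads T Ms :
  decomposes T -> perm_eq Ms [seq t.1 | t <- T] -> leads_to_direct_sum R Ms.
Proof.
move=> decT /(perm_iotaP 0)[Is permI ->].
pose t0 : 'M[F]_3 * (V1 * V2 * V3) := (0, (0, 0, 0)).
rewrite size_map in permI.
have permT : perm_eq T [seq nth t0 T i | i <- Is].
  by rewrite -{1}(mkseq_nth t0 T) /mkseq perm_map // perm_sym.
have /decomposes_direct_sum := decomposes_perm permT decT.
rewrite -map_comp; congr (leads_to_direct_sum _ _).
apply/eq_in_map => i; rewrite (perm_mem permI) mem_iota => /= iT.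
by rewrite (nth_map t0).
Qed.

End Summands.

(** * The block of a direct sum *)

Section Thickening.

Variable F : fieldType.

(** The tensor product of a function on the lines with a vector of V. *)
Definition thick_scale (V : vectType F) (v : V) : thick F^o -> thick V :=
  thick_map ( *:%R^~ v : F^o -> V).

Fact thick_scale_linear (V : vectType F) (v : V) : linear (thick_scale v).
Proof. by move=> a p q; apply/ffunP=> l; rewrite !ffunE scalerDl scalerA. Qed.

HB.instance Definition _ V v :=
  GRing.isLinear.Build F (thick F^o) (thick V) *:%R (@thick_scale V v)
    (thick_scale_linear v).

Lemma dim_thick (V : vectType F) : \dim {: thick V} = (4 * \dim {: V})%N.
Proof. by rewrite !dimvf /dim /= card_prod card_bool. Qed.

Lemma size_basis_of (V : vectType F) (X : seq V) U :
  basis_of U X -> size X = \dim U.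
Proof. by move=> bX; rewrite (@size_basis _ _ _ _ (in_tuple X)). Qed.

(** The products of a basis of V with bases of the functions on the lines,
    which may vary with the vector of V, form a basis of the thick space:
    they span it, and their number is its dimension. *)
Lemma basis_thick (V : vectType F) (I : eqType) (T : seq I) (v : I -> V)
    (P : I -> seq (thick F^o)) :
    basis_of fullv [seq v t | t <- T] ->
    (forall t, t \in T -> basis_of fullv (P t)) ->
  basis_of fullv [seq thick_scale (v t) p | t <- T, p <- P t].
Proof.
move=> bv bP; rewrite basisEdim; apply/andP; split; last first.
  rewrite dim_thick -(size_basis_of bv) size_map size_allpairs_dep.
  rewrite -(size_map (fun t => size (P t)) T).
  have /all_pred1P-> : all (pred1 4%N) [seq size (P t) | t <- T].
    rewrite all_map; apply/allP=> t /bP /size_basis_of /= ->.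
    by rewrite dim_thick dimvf /dim.
  by rewrite sumn_nseq size_nseq.
apply/subvP=> u _.
pose c (i : 'I_(size [seq v t | t <- T])) : thick F^o :=
  on_lines (fun l => coord (in_tuple [seq v t | t <- T]) i (u l) : F^o).
have -> : u = \sum_(i < size [seq v t | t <- T])
    thick_scale [seq v t | t <- T]`_i (c i).
  apply/ffunP=> l; rewrite sum_ffunE.
  rewrite {1}(coord_basis (X := in_tuple _) bv (memvf (u l))).
  by apply: eq_bigr => i _; rewrite on_linesE on_linesE.
apply: memv_suml => i _.
have /mapP[t tT ->] : [seq v t | t <- T]`_i \in [seq v t | t <- T].
  by rewrite mem_nth.
have : c i \in <<P t>>%VS by rewrite (span_basis (bP t tT)) memvf.
move/(memv_img (linfun (thick_scale (v t)))); rewrite limg_span lfunE.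
apply: subvP; apply: sub_span => w /mapP[p pP ->].
by rewrite lfunE; apply/allpairsPdep; exists t, p.
Qed.

Variables (V1 V2 V3 : vectType F).
Variable E : 'M[F]_3 -> seq ('M[F]_3 * (thick F^o * thick F^o * thick F^o)).

Definition refine (T : seq ('M[F]_3 * (V1 * V2 * V3)))
    : seq ('M[F]_3 * (thick V1 * thick V2 * thick V3)) :=
  [seq (e.1, (thick_scale t.2.1.1 e.2.1.1, thick_scale t.2.1.2 e.2.1.2,
              thick_scale t.2.2 e.2.2)) | t <- T, e <- E t.1].

(** Composing the intertwiner from the matrix e.1 to the block of the matrix
    t.1 with the thickening of the one from t.1 to R gives an intertwiner from
    e.1 to the block of R. *)
Lemma decomposes_block (R : 'End((V1 * V2 * V3)%type)) s T :
    decomposes R T ->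
    (forall t, t \in T -> decomposes (block s (brick t.1)) (E t.1)) ->
  decomposes (block s R) (refine T).
Proof.
case=> b1 b2 b3 summT dec1.
rewrite /decomposes /refine !map_allpairs /=.
have basis_refine (V : vectType F) (v : V1 * V2 * V3 -> V)
     (p : thick F^o * thick F^o * thick F^o -> thick F^o) :
   basis_of fullv [seq v t.2 | t <- T] ->
   (forall t, t \in T -> basis_of fullv [seq p e.2 | e <- E t.1]) ->
   basis_of fullv [seq thick_scale (v t.2) (p e.2) | t <- T, e <- E t.1].
  move=> bv bp.
  rewrite -(allpairs_mapr (fun t => thick_scale (v t.2)) (fun _ e => p e.2)).
  exact: basis_thick bv bp.
split.
- by apply: (basis_refine _ (fun w => w.1.1) (fun w => w.1.1)) => // t /dec1[].
- by apply: (basis_refine _ (fun w => w.1.2) (fun w => w.1.2)) => // t /dec1[].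
- by apply: (basis_refine _ snd snd) => // t /dec1[].
move=> _ /allpairsPdep[t [e [tT eE ->]]] u.
have [_ _ _ /(_ e eE) sum_e] := dec1 t tT.
have := block_intertwines s (summT t tT).
move=> /(_ (u.1.1 *: e.2.1.1, u.1.2 *: e.2.1.2, u.2 *: e.2.2)) /=.
by rewrite sum_e /= -!/(thick_scale _ _) !linearZ.
Qed.

End Thickening.

(** * One step on a 3 x 3 matrix *)

Section Eigensystem.

Variable F : fieldType.
Implicit Type A : 'M[F]_3.

Definition chiral A := A 0 1 * A 1 2 * A 2 0 != A 0 2 * A 2 1 * A 1 0.

Definition frob A : 'M[F]_3 := map_mx (fun a => a ^+ 2) A.

Definition tprod (p q : bool -> F) : thick F^o :=
  on_lines (fun l => p l.1 * q l.2 : F^o).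

(** The lines of direction i are labelled by their coordinates along the two
    other axes, c being one of them and k the other one; the result is a
    function of the coordinate along c. In characteristic 2 its values are the
    entry (k, i) of A, or of its transpose if [tr] holds, and the minor with
    rows c, k and columns c, i. *)
Definition bit_vec A (tr : bool) (i c k : 'I_3) (b : bool) : F :=
  let a x y := if tr then A y x else A x y in
  if b then a c i * a k c + a c c * a k i else a k i.

Definition eigvec A (i c d : 'I_3) (trc trd : bool) : thick F^o :=
  tprod (bit_vec A trc i c d) (bit_vec A trd i d c).

(** Each boolean selects an axis, and a factor is taken from the transpose when
    its direction or its coordinate is selected. Selecting no axis, then each
    axis in turn, gives in every thick space all four combinations of A and its
    transpose for the two factors, which is what a tensor product basis
    needs. *)
Definition eigtriple A (s0 s1 s2 : bool)
    : (thick F^o * thick F^o * thick F^o)%type :=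
  (eigvec A 0 1 2 (s0 || s1) (s0 || s2),
   eigvec A 1 0 2 (s1 || s0) (s1 || s2),
   eigvec A 2 0 1 (s2 || s0) (s2 || s1)).

Definition eigensystem A :=
  [:: ((frob A)^T, eigtriple A false false false);
      (frob A, eigtriple A true false false);
      (frob A, eigtriple A false true false);
      (frob A, eigtriple A false false true)].

Lemma tprodZ (a : F^o) p q :
  a *: tprod p q = on_lines (fun l => a * (p l.1 * q l.2) : F^o).
Proof. by apply/ffunP=> l; rewrite ffunE !on_linesE. Qed.

(** For each triple this amounts to twelve polynomial identities modulo 2, one
    for each outgoing edge of the cube. *)
Lemma eigensystem_summand A s e :
    2%N \in [pchar F] -> admissible s -> e \in eigensystem A ->
  summand (block s (brick A)) e.
Proof.
move=> /pcharf0 h2 adm_s e_in [[u v] w].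
(* The coefficients of the expanded polynomials are natural numbers up to 6,
   and these equations reduce them modulo 2. *)
have h3 : 3%:R = 1 :> F by rewrite (natrD _ 2 1) h2 add0r.
have h4 : 4%:R = 0 :> F by rewrite (natrD _ 2 2) h2 add0r.
have h5 : 5%:R = 1 :> F by rewrite (natrD _ 4 1) h4 add0r.
have h6 : 6%:R = 0 :> F by rewrite (natrD _ 4 2) h2 h4 add0r.
move: e_in; rewrite !inE => /or4P[] /eqP-> /=;
  rewrite brickE /brick_fun /= !mxE /eigvec /= !tprodZ;
  rewrite (block_sweep _ _ _ adm_s (brickE A));
  lazy beta iota zeta delta [sweep bit_vec brick_fun fst snd];
  congr (_, _, _); apply/ffunP => -[[] []]; rewrite !on_linesE /corners /=.
all: ring: h2 h3 h4 h5 h6.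
Qed.

(** The coordinates of a function of two bits in a tensor product basis, by
    Cramer's rule in each factor. *)
Lemma tprod_basis (p p' q q' : bool -> F) (X : seq (thick F^o)) :
    p false * p' true != p true * p' false ->
    q false * q' true != q true * q' false ->
    (size X <= 4)%N ->
    {subset [:: tprod p q; tprod p q'; tprod p' q; tprod p' q'] <= X} ->
  basis_of fullv X.
Proof.
move=> detp detq sizeX subX.
have dp : p false * p' true - p true * p' false != 0 by rewrite subr_eq0.
have dq : q false * q' true - q true * q' false != 0 by rewrite subr_eq0.
rewrite basisEdim dim_thick dimvf /dim /= sizeX andbT.
apply/subvP=> u _; pose dpq := (p false * p' true - p true * p' false) *
  (q false * q' true - q true * q' false).
pose coef (f g : bool -> F) : F := (u (false, false) * f true * g true
  - u (false, true) * f true * g false - u (true, false) * f false * g true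
  + u (true, true) * f false * g false) / dpq.
have -> : u = coef p' q' *: tprod p q - coef p' q *: tprod p q'
    - coef p q' *: tprod p' q + coef p q *: tprod p' q'.
  apply/ffunP=> -[[] []];
  rewrite !(ffunE, on_linesE) /= /GRing.scale /= /coef /dpq; field; exact/andP.
have inX w : w \in [:: tprod p q; tprod p q'; tprod p' q; tprod p' q'] ->
    w \in <<X>>%VS by move=> /subX /memv_span.
by rewrite rpredD ?rpredB ?rpredZ ?inX // !inE eqxx ?orbT.
Qed.

Lemma bit_vec_det A i c k :
    A k i * A c k * A i c != A i k * A k c * A c i ->
  bit_vec A false i c k false * bit_vec A true i c k true !=
    bit_vec A false i c k true * bit_vec A true i c k false.
Proof.
rewrite /bit_vec -subr_eq0 => h; rewrite -subr_eq0.
by apply: contra_neq h => <-; ring.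
Qed.

Lemma eigensystem_decomposes A s :
    2%N \in [pchar F] -> chiral A -> admissible s ->
  decomposes (block s (brick A)) (eigensystem A).
Proof.
move=> charF chA adm_s; split; last by move=> e; apply: eigensystem_summand.
- apply: (@tprod_basis (bit_vec A false 0 1 2) (bit_vec A true 0 1 2)
           (bit_vec A false 0 2 1) (bit_vec A true 0 2 1)) => //.
  + apply: bit_vec_det; apply: contra_neq chA => h; ring: h.
  + apply: bit_vec_det; apply: contra_neq chA => h; ring: h.
  + by move=> w; rewrite !inE => /or4P[] ->; rewrite ?orbT.
- apply: (@tprod_basis (bit_vec A false 1 0 2) (bit_vec A true 1 0 2)
           (bit_vec A false 1 2 0) (bit_vec A true 1 2 0)) => //.
  + apply: bit_vec_det; apply: contra_neq chA => h; ring: h.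
  + apply: bit_vec_det; apply: contra_neq chA => h; ring: h.
  + by move=> w; rewrite !inE => /or4P[] ->; rewrite ?orbT.
- apply: (@tprod_basis (bit_vec A false 2 0 1) (bit_vec A true 2 0 1)
           (bit_vec A false 2 1 0) (bit_vec A true 2 1 0)) => //.
  + apply: bit_vec_det; apply: contra_neq chA => h; ring: h.
  + apply: bit_vec_det; apply: contra_neq chA => h; ring: h.
  + by move=> w; rewrite !inE => /or4P[] ->; rewrite ?orbT.
Qed.

End Eigensystem.

(** * Iteration *)

Section Iteration.

Variable F : fieldType.
Implicit Type A : 'M[F]_3.

Lemma chiral_tr A : chiral A -> chiral A^T.
Proof. rewrite /chiral !mxE; apply: contra_neq => h; ring: h. Qed.

(** The two sides are mapped to their squares, and the Frobenius endomorphism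
    of a field is injective. *)
Lemma chiral_frob A : 2%N \in [pchar F] -> chiral A -> chiral (frob A).
Proof.
move=> charF; rewrite /chiral !mxE -!exprMn -!(pFrobenius_autE charF).
by rewrite (inj_eq (fmorph_inj _)).
Qed.

Definition frob_iter A n : 'M[F]_3 := map_mx (fun a => a ^+ (2 ^ n)) A.

Lemma frob_iterS A n : frob (frob_iter A n) = frob_iter A n.+1.
Proof. by apply/matrixP=> i j; rewrite !mxE -exprM expnSr. Qed.

Lemma frob_tr A : frob A^T = (frob A)^T.
Proof. by apply/matrixP=> i j; rewrite !mxE. Qed.

Lemma brick_decomposes A :
  decomposes (brick A) [:: (A, (1, 1, 1) : F^o * F^o * F^o)].
Proof.
have basis1 : basis_of fullv [:: 1 : F^o].
  rewrite basisEdim dimvf /dim /= andbT; apply/subvP=> a _.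
  by rewrite span_seq1; apply/vlineP; exists a; rewrite [RHS]mulr1.
split=> // t; rewrite inE => /eqP-> u /=.
by rewrite ![_ *: 1]mulr1; case: (u) => [[x y] z]; case: (brick A _) => [[]].
Qed.

Lemma iter_block_decomposes A ord n :
    2%N \in [pchar F] -> chiral A -> (forall k, admissible (ord k)) ->
  exists T p q,
    [/\ decomposes (iter_block A ord n) T,
        perm_eq [seq t.1 | t <- T]
          (nseq p (frob_iter A n) ++ nseq q (frob_iter A n)^T),
        (p + q = 4 ^ n)%N & (p = q + 2 ^ n)%N].
Proof.
move=> charF chA adm; elim: n => [|n [T [p [q [decT permT sum_pq diff_pq]]]]].
  exists [:: (A, (1, 1, 1) : F^o * F^o * F^o)], 1%N, 0%N; split=> //.
    exact: brick_decomposes.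
  rewrite /= (_ : frob_iter A 0 = A) //.
  by apply/matrixP=> i j; rewrite mxE expr1.
have chAn : chiral (frob_iter A n).
  elim: n {T p q decT permT sum_pq diff_pq} => [|n IH].
    by move: chA; rewrite /chiral !mxE !expr1.
  by rewrite -frob_iterS; apply: chiral_frob.
exists (refine (@eigensystem F) T), (3 * p + q)%N, (p + 3 * q)%N; split.
- apply: decomposes_block => // t tT; apply: eigensystem_decomposes => //.
  have : t.1 \in [seq t.1 | t <- T] by apply: map_f.
  rewrite (perm_mem permT) mem_cat !mem_nseq.
  by case/orP=> /andP[_ /eqP->] //; apply: chiral_tr.
- pose quad (M : 'M[F]_3) := [:: (frob M)^T; frob M; frob M; frob M].
  rewrite map_allpairs.
  have -> : [seq e.1 | t <- T, e <- eigensystem t.1] =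
      [seq N | M <- [seq t.1 | t <- T], N <- quad M].
    by rewrite allpairs_mapl; congr flatten; apply: eq_map.
  apply: perm_trans (perm_allpairs_dep _ permT (fun _ _ => perm_refl _)) _.
  have flat_nseq m M :
      [seq N | M <- nseq m M, N <- quad M] = flatten (nseq m (quad M)).
    by rewrite map_nseq.
  rewrite allpairs_cat !flat_nseq /quad !frob_tr trmxK frob_iterS.
  apply/permP=> a.
  rewrite !count_cat !count_flatten !map_nseq !sumn_nseq !count_nseq /=; ring.
- by rewrite expnS -sum_pq; ring.
- by rewrite diff_pq expnS; ring.
Qed.

End Iteration.

Theorem corollary11 (F : finFieldType) (charF : 2%N \in [pchar F])
    (A : 'M[F]_3)
    (hA : A 0 1 * A 1 2 * A 2 0 <> A 0 2 * A 2 1 * A 1 0)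
    (ord : nat -> seq cube) (hord : forall k : nat, admissible (ord k))
    (n : nat) :
  let A' : 'M[F]_3 := \matrix_(i < 3, j < 3) A i j ^+ (2 ^ n) in
  exists p q : nat,
    [/\ p%:Q = 2%:Q ^ (2 * n%:Z - 1) + 2%:Q ^ (n%:Z - 1),
        q%:Q = 2%:Q ^ (2 * n%:Z - 1) - 2%:Q ^ (n%:Z - 1) &
        leads_to_direct_sum (iter_block A ord n) (nseq p A' ++ nseq q A'^T)].
Proof.
move=> A'.
have chA : chiral A by apply/eqP.
have [T [p [q [decT permT sum_pq diff_pq]]]] :=
  iter_block_decomposes n charF chA hord.
have half m : 2%:Q ^ (m%:Z - 1) = (2 ^ m)%N%:R / 2%:Q.
  by rewrite expfzDr // natrX.
have sumQ : (2 ^ (2 * n))%N%:R = p%:R + q%:R :> rat.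
  by rewrite -natrD sum_pq expnM.
have diffQ : p%:R = q%:R + (2 ^ n)%N%:R :> rat.
  by rewrite -natrD -diff_pq.
exists p, q; rewrite -PoszM !half sumQ -!pmulrn; split.
- by rewrite diffQ; field.
- by rewrite diffQ; field.
- apply: decomposes_leads decT _; rewrite perm_sym.
  rewrite (_ : A' = frob_iter A n) //.
  by apply/matrixP=> i j; rewrite !mxE.
Qed.
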